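(* For every $n\in\mathbb{N}$, the form $q_n^5$ can be decomposed as $$\begin{aligned} 15120\,q_n^5&=\sum_{i_1<i_2<i_3<i_4<i_5}(x_{i_1}\pm x_{i_2}\pm x_{i_3}\pm x_{i_4}\pm x_{i_5})^{10}-2(n-7)\sum_{i_1<i_2<i_3<i_4}(x_{i_1}\pm x_{i_2}\pm x_{i_3}\pm x_{i_4})^{10}\\ &\quad+2(n^2-13n+36)\sum_{i_1<i_2<i_3}(x_{i_1}\pm x_{i_2}\pm x_{i_3})^{10}\\ &\quad+\frac{2}{3}\sum_{i_1<i_2<i_3}\bigl[(2x_{i_1}\pm x_{i_2}\pm x_{i_3})^{10}+(x_{i_1}\pm 2x_{i_2}\pm x_{i_3})^{10}+(x_{i_1}\pm x_{i_2}\pm 2x_{i_3})^{10}\bigr]\\ &\quad-\frac{4}{3}(n^3-18n^2+90n-226)\sum_{i_1<i_2}(x_{i_1}\pm x_{i_2})^{10}\\ &\quad-\frac{4}{3}(n-4)\sum_{i_1<i_2}\bigl[(2x_{i_1}\pm x_{i_2})^{10}+(x_{i_1}\pm 2x_{i_2})^{10}\bigr]\\ &\quad+\frac{2}{3}(n^4-22n^3+2195n^2-15086n+35592)\sum_{i_1}x_{i_1}^{10}, \end{aligned}$$ which is a decomposition of size $$16\binom{n}{5}+8\binom{n}{4}+16\binom{n}{3}+6\binom{n}{2}+n=\frac{2}{15}n^5-n^4+\frac{16}{3}n^3-8n^2+\frac{68}{15}n$$ for $n\geq 5$ and $n\neq 7$, and of size $1029$ for $n=7$.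
   Context: Here $q_n=x_1^2+\cdots+x_n^2\in\mathbb{C}[x_1,\dots,x_n]$. Notation: $\sum_{i_1<\cdots<i_k}(a_1x_{i_1}\pm a_2x_{i_2}\pm\cdots\pm a_kx_{i_k})^m$ denotes the sum over all choices of indices $1\le i_1<\cdots<i_k\le n$ and over all $2^{k-1}$ choices of signs multiplying $a_2,\dots,a_k$ (each $\pm$ is an independent sign, and all choices are summed). In the case $k>n$, the terms $x_{i_{n+1}},\dots,x_{i_k}$ are assumed to be $0$, so that the sum becomes $\sum_{i_1<\cdots<i_n}(a_1x_{i_1}\pm\cdots\pm a_nx_{i_n})^m$. A decomposition of size $r$ of a form $f$ of degree $d$ is an expression of $f$ as a sum of $d$-th powers of $r$ different linear forms over $\mathbb{C}$; here nonzero scalar coefficients are absorbed into the linear forms (over $\mathbb{C}$), and summands with zero coefficient are discarded.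
   Formalization: Sums over i_1<...<i_k with k>n are taken to be empty (0), since setting the missing x's to 0 makes the identity false for n=1,...,4; and n=9 is excluded from the general size formula, with size 4257 there, because 2(n^2-13n+36) vanishes at n=9. *)

(* Defs.v *)
From mathcomp Require Import all_boot all_order all_algebra.
From mathcomp Require Import complex mpoly reals.

Set Implicit Arguments.
Unset Strict Implicit.
Unset Printing Implicit Defensive.

Import GRing.Theory Num.Theory.
Local Open Scope ring_scope.

Definition qform (K : numClosedFieldType) (n : nat) : {mpoly K[n]} :=
  \sum_(i < n) 'X_i ^+ 2.

(* a_1 x_{i_1} + e_2 a_2 x_{i_2} + ... + e_k a_k x_{i_k} with k = size a and
   e_2, ..., e_k in {1, -1}; an entry [true] of [s] stands for the sign -1.
   The first summand carries no sign, hence the prefix [false]. *)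
Definition pm_form (K : numClosedFieldType) (n : nat) (a : seq K)
    (i : (size a).-tuple 'I_n) (s : (size a).-1.-tuple bool) : {mpoly K[n]} :=
  \sum_(j < size a)
    ((-1) ^+ nth false (false :: s) j * a`_j) *: 'X_(tnth i j).

(* A linear combination of powers of linear forms is recorded as the list of
   its summands, each being a pair (coefficient, linear form); [pm_terms c a]
   is c * sum_{i_1 < ... < i_k} (a_1 x_{i_1} +- ... +- a_k x_{i_k})^m.
   There is no such choice of indices, hence no summand, when k > n. *)
Definition pm_terms (K : numClosedFieldType) (n : nat) (c : K) (a : seq K) :
    seq (K * {mpoly K[n]}) :=
  [seq (c, pm_form i s)
     | i <- enum [set i : (size a).-tuple 'I_n | sorted ltn (map val i)],
       s <- enum {: (size a).-1.-tuple bool}].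

Definition power_sum (K : numClosedFieldType) (n d : nat)
    (W : seq (K * {mpoly K[n]})) : {mpoly K[n]} :=
  \sum_(w <- W) w.1 *: w.2 ^+ d.

Definition is_decomposition (K : numClosedFieldType) (n d : nat) (f : {mpoly K[n]})
    (L : seq {mpoly K[n]}) : Prop :=
  [/\ {in L, forall l, l \is 1.-homog}, uniq L & f = \sum_(l <- L) l ^+ d].

(* The linear forms obtained from (1/N) * sum_w w.1 * w.2^d by discarding the
   summands with coefficient 0 and absorbing the other coefficients. *)
Definition absorb (K : numClosedFieldType) (n d : nat) (N : K)
    (W : seq (K * {mpoly K[n]})) : seq {mpoly K[n]} :=
  [seq d.-root (w.1 / N) *: w.2 | w <- W & w.1 / N != 0].

(* Main.v *)
Require Import Defs.
From mathcomp Require Import all_boot all_order all_algebra.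
From mathcomp Require Import complex mpoly reals.
From mathcomp Require Import ring zify.

Set Implicit Arguments.
Unset Strict Implicit.
Unset Printing Implicit Defensive.

Import GRing.Theory Num.Theory.
Local Open Scope ring_scope.

(** The identity. Write c(y) = sum_m y^(2m) s^m / (2m)!, the series of
    cosh (y sqrt s). Since exp turns sums into products, averaging
    (y_1 +- ... +- y_k)^10 over the signs gives 10! times the coefficient of
    s^5 in c(y_1) ... c(y_k) ([sum_signs_expr_fst]). Evaluated at a point x,
    each sum of the decomposition is therefore the coefficient of s^5 in a
    symmetric sum of products of the series c(x_i) and c(2 x_i). Newton-type
    identities ([osum_nseq5] and its companions) rewrite these symmetric sums
    as polynomials in sums such as sum_i c(x_i)^j c(2 x_i)^l, and the
    coefficient of s^m in such a sum is a rational number times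
    Y_m = sum_i x_i^(2m). Both sides have thus become explicit polynomials in
    Y_0 = n, Y_1, ..., Y_5, which are compared in [quintic_point_identity]:
    all monomials on the right cancel, except a multiple of Y_1^5 = q_n(x)^5.
    A polynomial over an infinite domain is determined by its values
    ([meval_inj]), so this proves the identity of forms.

    The size. The linear forms obtained are pairwise distinct, even up to
    scalars: the variables that occur in a form give back the indices, and
    the quotients of the coefficients by the first one, whose sign is fixed,
    give back the signs and the shape (a_1, ..., a_k) up to proportionality;
    the ten shapes that occur are not proportional to each other
    ([absorb_uniq]). Hence the size is the number of summands with nonzero
    coefficient. As polynomials in n, the coefficients factor as 2 (7 - n),
    2 (n - 4)(n - 9), (4/3) (4 - n), or have no root among the natural
    numbers; so for n >= 5 a family of summands disappears exactly at n = 7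
    and at n = 9. *)

(** * Subsequences, sign choices and the summands *)

Section Subsequences.
Variable T : eqType.
Implicit Types (x : T) (xs ys : seq T).

Fixpoint subs k xs : seq (seq T) :=
  if k is k'.+1 then
    if xs is x :: xs' then map (cons x) (subs k' xs') ++ subs k xs' else [::]
  else [:: [::]].

Lemma subs0 xs : subs 0 xs = [:: [::]].
Proof. by case: xs. Qed.

Lemma mem_subs k xs ys : (ys \in subs k xs) = (size ys == k) && subseq ys xs.
Proof.
elim: xs k ys => [|x xs IH] [|k] [|y ys]; rewrite ?andbF //=.
  by rewrite mem_cat IH orbF; apply/mapP => -[].
rewrite mem_cat IH /= eqSS.
have [->|neq_xy] := eqVneq y x; last first.
  by case: mapP => // -[zs _ [eq_yx]]; rewrite eq_yx eqxx in neq_xy.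
rewrite mem_map => [|u v []//]; rewrite IH.
case: eqP => //= _; case: (boolP (subseq ys xs)) => //= /negP nsub.
apply/negP => sub_xys; apply: nsub; apply: subseq_trans sub_xys.
exact: subseq_cons.
Qed.

Lemma subs_uniq k xs : uniq xs -> uniq (subs k xs).
Proof.
elim: xs k => [|x xs IH] [|k] //= /andP[x_notin uniq_xs].
rewrite cat_uniq map_inj_uniq ?IH // => [|u v []//].
rewrite andbT; apply/hasPn => ys; rewrite mem_subs => /andP[_ sub_ys].
apply/mapP => -[zs _ def_ys]; move: sub_ys x_notin.
by rewrite def_ys => /mem_subseq -> //; rewrite mem_head.
Qed.

End Subsequences.

Lemma subs_map (S T : eqType) (f : S -> T) k xs :
  subs k (map f xs) = map (map f) (subs k xs).
Proof.
elim: xs k => [|x xs IH] [|k] //=.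
by rewrite map_cat !IH -!map_comp.
Qed.

Fixpoint signs k : seq (seq bool) :=
  if k is k'.+1 then map (cons false) (signs k') ++ map (cons true) (signs k')
  else [:: [::]].

Lemma mem_signs k s : (s \in signs k) = (size s == k).
Proof.
elim: k s => [|k IH] [|b s] //=.
  by apply/negP; rewrite mem_cat => /orP[] /mapP[].
rewrite mem_cat eqSS -IH; case: b.
  rewrite mem_map => [|u v []//].
  by case: mapP => [[u _ []]|].
rewrite mem_map => [|u v []//].
by case: (_ \in _) => //=; apply/mapP => -[].
Qed.

Lemma signs_uniq k : uniq (signs k).
Proof.
elim: k => [|k IH] //=.
rewrite cat_uniq !map_inj_uniq ?IH => [|u v []//|u v []//].
by rewrite andbT; apply/hasPn => _ /mapP[s _ ->]; apply/mapP => -[].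
Qed.

Lemma perm_signs k : perm_eq (map val (enum {: k.-tuple bool})) (signs k).
Proof.
apply: uniq_perm; rewrite ?signs_uniq //.
  by rewrite map_inj_uniq ?enum_uniq //; apply: val_inj.
move=> s; rewrite mem_signs; apply/mapP/eqP => [[t _ ->]|size_s].
  exact: size_tuple.
by exists (Tuple (introT eqP size_s)); rewrite ?mem_enum.
Qed.

(** Increasing tuples of indices are the subsequences of 0, ..., n - 1; in this
    form sums over them can be treated by induction on the list of variables. *)
Lemma perm_sorted_tuples n k :
  perm_eq (map val (enum [set i : k.-tuple 'I_n | sorted ltn (map val i)]))
          (subs k (enum 'I_n)).
Proof.
apply: uniq_perm; first by rewrite map_inj_uniq ?enum_uniq //; apply: val_inj.
  exact: subs_uniq (enum_uniq _).
have sorted_val (xs : seq 'I_n) :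
    sorted ltn (map val xs) = sorted (relpre val ltn) xs.
  by rewrite sorted_map.
have ltn_tr : transitive (relpre (@nat_of_ord n) ltn).
  by move=> ? ? ?; apply: ltn_trans.
have sorted_enum : sorted (relpre (@nat_of_ord n) ltn) (enum 'I_n).
  by rewrite -sorted_val val_enum_ord iota_ltn_sorted.
move=> xs; rewrite mem_subs; apply/mapP/andP => [[t + ->]|[/eqP size_xs sub_xs]].
  rewrite mem_enum inE sorted_val size_tuple => sorted_t; split=> //.
  rewrite (_ : val t = [seq i <- enum 'I_n | i \in t]) ?filter_subseq //.
  apply: (irr_sorted_eq ltn_tr) => // [i||i]; first exact: ltnn.
    exact: sorted_filter.
  by rewrite mem_filter mem_enum andbT.
exists (Tuple (introT eqP size_xs)) => //.
rewrite mem_enum inE sorted_val /=.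
exact: subseq_sorted sub_xs sorted_enum.
Qed.

Section SignedForms.
Variables (K : numClosedFieldType) (n : nat).

(** [pm_form] with lists in place of tuples, which frees the indices and signs
    from the dependency on the number of coefficients. *)
Definition signed_form (a : seq K) (xs : seq 'I_n) (s : seq bool) :
    {mpoly K[n]} :=
  \sum_(p <- zip (zip (false :: s) a) xs) ((-1) ^+ p.1.1 * p.1.2) *: 'X_p.2.

Lemma pm_formE (a : seq K) (i : (size a).-tuple 'I_n)
    (s : (size a).-1.-tuple bool) :
  pm_form i s = signed_form a i s.
Proof.
rewrite /pm_form /signed_form.
case: a i s => [|a0 a] i s.
  by rewrite big_ord0 (tuple0 i) big_nil.
pose i0 := tnth i ord0; pose z0 : bool * K * 'I_n := ((false, 0), i0).
have size_s : size (false :: s) = size (a0 :: a) by rewrite /= size_tuple.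
have size_z : size (zip (false :: s) (a0 :: a)) = size i.
  by rewrite size_zip size_s minnn size_tuple.
rewrite (big_nth z0) big_mkord size_zip size_z minnn size_tuple.
by apply: eq_bigr => j _; rewrite !nth_zip // /= (tnth_nth i0).
Qed.

Lemma pm_termsE (c : K) (a : seq K) :
  perm_eq (pm_terms n c a)
    [seq (c, signed_form a xs s) | xs <- subs (size a) (enum 'I_n),
                                   s <- signs (size a).-1].
Proof.
rewrite /pm_terms.
have -> : [seq (c, pm_form i s)
     | i <- enum [set i : (size a).-tuple 'I_n | sorted ltn (map val i)],
       s <- enum {: (size a).-1.-tuple bool}]
 = [seq (c, signed_form a xs s)
     | xs <- map val (enum [set i : (size a).-tuple 'I_n
                            | sorted ltn (map val i)]),
       s <- map val (enum {: (size a).-1.-tuple bool})].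
  rewrite allpairs_mapl; congr flatten; apply: eq_map => i.
  by rewrite -[RHS]map_comp; apply: eq_map => s /=; rewrite pm_formE.
apply: perm_allpairs; [exact: perm_sorted_tuples | exact: perm_signs].
Qed.

End SignedForms.

(** * Symmetric sums and Newton-type identities *)

Section OrderedSums.
Variables (T : eqType) (B : comNzRingType).
Implicit Types (f g : T -> B) (fs : seq (T -> B)) (xs : seq T).

(** When all the functions in fs are the same f, this is the elementary
    symmetric function of degree [size fs] of the values of f on xs. *)
Definition osum fs xs : B :=
  \sum_(ys <- subs (size fs) xs) \prod_(p <- zip fs ys) p.1 p.2.

Lemma osum_nil xs : osum [::] xs = 1.
Proof. by rewrite /osum subs0 big_seq1 big_nil. Qed.

Lemma osum_nilr f fs : osum (f :: fs) [::] = 0.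
Proof. by rewrite /osum big_nil. Qed.

Lemma osum_cons f fs x xs :
  osum (f :: fs) (x :: xs) = f x * osum fs xs + osum (f :: fs) xs.
Proof.
rewrite /osum /= big_cat big_map /= mulr_sumr; congr (_ + _).
by apply: eq_bigr => ys _; rewrite big_cons.
Qed.

Definition psum f xs : B := \sum_(x <- xs) f x.

Lemma psum_nil f : psum f [::] = 0.
Proof. by rewrite /psum big_nil. Qed.

Lemma psum_cons f x xs : psum f (x :: xs) = f x + psum f xs.
Proof. by rewrite /psum big_cons. Qed.

Lemma osum1 f xs : osum [:: f] xs = psum f xs.
Proof.
elim: xs => [|x xs IH]; first by rewrite osum_nilr psum_nil.
by rewrite osum_cons osum_nil IH psum_cons mulr1.
Qed.

Lemma osum2 f g xs :
  osum [:: f; g] xs + osum [:: g; f] xs =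
  psum f xs * psum g xs - psum (fun x => f x * g x) xs.
Proof.
elim: xs => [|x xs IH]; first by rewrite !osum_nilr !psum_nil; ring.
move/(canRL (addrK _)): IH => IH.
by rewrite !osum_cons !psum_cons !osum1 IH; ring.
Qed.

Lemma osum_nseq2 f xs :
  2 * osum [:: f; f] xs = psum f xs ^+ 2 - psum (fun x => f x ^+ 2) xs.
Proof.
rewrite -[psum (fun x => f x ^+ 2) xs]/(psum (fun x => f x * f x) xs).
by rewrite mulr_natl mulr2n osum2 expr2.
Qed.

(** Adding a point x to the list changes a symmetric sum by multiples of
    symmetric sums of one factor less; this is how each of the following
    identities is deduced from the preceding ones. *)
Lemma osum3 f g xs :
  2 * (osum [:: g; f; f] xs + osum [:: f; g; f] xs + osum [:: f; f; g] xs) =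
  psum g xs * (psum f xs ^+ 2 - psum (fun x => f x ^+ 2) xs)
  - 2 * psum f xs * psum (fun x => f x * g x) xs
  + 2 * psum (fun x => f x ^+ 2 * g x) xs.
Proof.
elim: xs => [|x xs IH]; first by rewrite !osum_nilr !psum_nil; ring.
rewrite !osum_cons !psum_cons.
rewrite [LHS](_ : _ =
  g x * (2 * osum [:: f; f] xs) +
  2 * f x * (osum [:: f; g] xs + osum [:: g; f] xs) +
  2 * (osum [:: g; f; f] xs + osum [:: f; g; f] xs + osum [:: f; f; g] xs)).
  by rewrite IH osum2 osum_nseq2; ring.
ring.
Qed.

Lemma osum_nseq3 f xs :
  6 * osum [:: f; f; f] xs =
  psum f xs ^+ 3 - 3 * psum f xs * psum (fun x => f x ^+ 2) xs
  + 2 * psum (fun x => f x ^+ 3) xs.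
Proof.
elim: xs => [|x xs IH]; first by rewrite !osum_nilr !psum_nil; ring.
rewrite osum_cons !psum_cons [LHS](_ : _ =
  3 * f x * (2 * osum [:: f; f] xs) + 6 * osum [:: f; f; f] xs); last by ring.
by rewrite IH osum_nseq2; ring.
Qed.

Lemma osum_nseq4 f xs :
  24 * osum [:: f; f; f; f] xs =
  psum f xs ^+ 4 - 6 * psum f xs ^+ 2 * psum (fun x => f x ^+ 2) xs
  + 3 * psum (fun x => f x ^+ 2) xs ^+ 2
  + 8 * psum f xs * psum (fun x => f x ^+ 3) xs
  - 6 * psum (fun x => f x ^+ 4) xs.
Proof.
elim: xs => [|x xs IH]; first by rewrite !osum_nilr !psum_nil; ring.
rewrite osum_cons !psum_cons [LHS](_ : _ =
  4 * f x * (6 * osum [:: f; f; f] xs) + 24 * osum [:: f; f; f; f] xs);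
  last by ring.
by rewrite IH osum_nseq3; ring.
Qed.

Lemma osum_nseq5 f xs :
  120 * osum [:: f; f; f; f; f] xs =
  psum f xs ^+ 5 - 10 * psum f xs ^+ 3 * psum (fun x => f x ^+ 2) xs
  + 15 * psum f xs * psum (fun x => f x ^+ 2) xs ^+ 2
  + 20 * psum f xs ^+ 2 * psum (fun x => f x ^+ 3) xs
  - 20 * psum (fun x => f x ^+ 2) xs * psum (fun x => f x ^+ 3) xs
  - 30 * psum f xs * psum (fun x => f x ^+ 4) xs
  + 24 * psum (fun x => f x ^+ 5) xs.
Proof.
elim: xs => [|x xs IH]; first by rewrite !osum_nilr !psum_nil; ring.
rewrite osum_cons !psum_cons [LHS](_ : _ =
  5 * f x * (24 * osum [:: f; f; f; f] xs)
  + 120 * osum [:: f; f; f; f; f] xs); last by ring.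
by rewrite IH osum_nseq4; ring.
Qed.

End OrderedSums.

(** * Sums over signs as coefficients of products of hyperbolic cosines *)

Section EvenCoefficients.
Variable R : nzRingType.
Implicit Types p q : {poly R}.

(** The coefficients of p(t^2) as an exponential generating function of t. In
    this normalization those of cosh (y t) are the powers of y, and the
    coefficients of products are integral combinations (see [ecoefM]). *)
Definition ecoef p m : R := (2 * m)`!%:R * p`_m.

Lemma ecoefD p q m : ecoef (p + q) m = ecoef p m + ecoef q m.
Proof. by rewrite /ecoef coefD mulrDr. Qed.

End EvenCoefficients.

Section SignSums.
Variables (K : numFieldType) (d : nat).
Implicit Types (y z : K) (zs : seq K).

(** The series exp(y t) up to degree 2d in t. *)
Definition exp_poly y : {poly K} := \poly_(m < (2 * d).+1) (y ^+ m / m`!%:R).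

(** The series cosh(y t) up to degree 2d in t, as a polynomial in s = t^2. *)
Definition cosh_poly y : {poly K} :=
  \poly_(m < d.+1) (y ^+ (2 * m) / (2 * m)`!%:R).

Let fact_neq0 m : m`!%:R != 0 :> K.
Proof. by rewrite pnatr_eq0 -lt0n fact_gt0. Qed.

(** The binomial theorem, read as exp(y) exp(z) = exp(y + z). *)
Lemma coef_prod_exp_poly zs m : (m <= 2 * d)%N ->
  (\prod_(z <- zs) exp_poly z)`_m = (\sum_(z <- zs) z) ^+ m / m`!%:R.
Proof.
elim: zs m => [|z zs IH] m le_m.
  rewrite !big_nil coef1 expr0n.
  by case: m le_m => [|m] _; rewrite ?divr1 ?mul0r.
rewrite !big_cons coefM addrC exprDn mulr_suml; apply: eq_bigr => j _.
have le_jm : (j <= m)%N by rewrite -ltnS.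
rewrite coef_poly ltnS (leq_trans le_jm) // IH ?(leq_trans (leq_subr _ _)) //.
rewrite -(bin_fact le_jm) -mulr_natr !natrM; field.
by rewrite !fact_neq0 pnatr_eq0 -lt0n bin_gt0.
Qed.

Lemma exp_polyD_opp y :
  exp_poly y + exp_poly (- y) = (2%:R *: cosh_poly y) \Po 'X^2.
Proof.
apply/polyP => m; rewrite coefD coef_comp_poly_Xn // coefZ !coef_poly ltnS.
rewrite exprNn -signr_odd dvdn2; case: (boolP (odd m)) => [odd_m|even_m] /=.
  by case: ifP => _; rewrite ?addr0 // expr1 mulN1r mulNr subrr.
have -> : m = (2 * m./2)%N by rewrite mul2n even_halfK.
rewrite leq_mul2l mulKn // ltnS; case: ifP => _; last by rewrite addr0 mulr0.
by rewrite mul1r mulr_natl mulr2n.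
Qed.

Lemma sum_signs_prod (E : K -> {poly K}) zs :
  \sum_(s <- signs (size zs)) \prod_(p <- zip s zs) E ((-1) ^+ p.1 * p.2)
  = \prod_(z <- zs) (E z + E (- z)).
Proof.
elim: zs => [|z zs IH]; first by rewrite big_seq1 !big_nil.
rewrite /= big_cat !big_map big_cons -IH mulrDl !mulr_sumr.
by congr (_ + _); apply: eq_bigr => s _; rewrite big_cons /= ?mul1r ?mulN1r.
Qed.

Lemma sum_signs_expr zs :
  \sum_(s <- signs (size zs))
     (\sum_(p <- zip s zs) (-1) ^+ p.1 * p.2) ^+ (2 * d)
  = 2 ^+ size zs * ecoef (\prod_(z <- zs) cosh_poly z) d.
Proof.
transitivity
  ((2 * d)`!%:R * (\prod_(z <- zs) (exp_poly z + exp_poly (- z)))`_(2 * d)).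
  rewrite -sum_signs_prod coef_sum mulr_sumr; apply: eq_bigr => s _.
  rewrite -(big_map (fun p : bool * K => (-1) ^+ p.1 * p.2) xpredT exp_poly).
  by rewrite coef_prod_exp_poly // big_map mulrC divfK.
under eq_bigr do rewrite exp_polyD_opp.
rewrite -rmorph_prod coef_comp_poly_Xn // dvdn_mulr // mulKn //.
rewrite scaler_prod coefZ big_const_seq count_predT iter_mulr_1 /ecoef; ring.
Qed.

Lemma sum_negb_signs s zs :
  \sum_(p <- zip (map negb s) zs) (-1) ^+ p.1 * p.2
  = - \sum_(p <- zip s zs) (-1) ^+ p.1 * p.2 :> K.
Proof.
elim: s zs => [|b s IH] [|z zs]; rewrite ?big_nil ?oppr0 //=.
by rewrite !big_cons IH opprD signrN mulNr.
Qed.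

(** The exponent being even, reversing all the signs does not change a
    summand, so fixing the first sign halves the sum over all signs. *)
Lemma sum_signs_expr_fst z zs :
  \sum_(s <- signs (size zs))
     (\sum_(p <- zip (false :: s) (z :: zs)) (-1) ^+ p.1 * p.2) ^+ (2 * d)
  = 2 ^+ size zs * ecoef (\prod_(y <- z :: zs) cosh_poly y) d.
Proof.
have perm_negb : perm_eq (signs (size zs)) (map (map negb) (signs (size zs))).
  apply: uniq_perm; rewrite ?signs_uniq //.
    by rewrite map_inj_uniq ?signs_uniq //; apply: inj_map; apply: negb_inj.
  move=> s; rewrite mem_signs; apply/eqP/mapP => [size_s|[t]].
    exists (map negb s); first by rewrite mem_signs size_map size_s.
    by rewrite -map_comp map_id_in // => b _ /=; rewrite negbK.
  by rewrite mem_signs => /eqP <- ->; rewrite size_map.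
apply: (@mulfI _ 2%:R); first by rewrite pnatr_eq0.
rewrite mulrA -exprS -[(size zs).+1]/(size (z :: zs)) -sum_signs_expr.
rewrite [signs (size (z :: zs))]/= big_cat !big_map mulr_natl mulr2n.
congr (_ + _).
rewrite [RHS](perm_big _ perm_negb) big_map; apply: eq_bigr => s _.
rewrite -[true :: map negb s]/(map negb (false :: s)) sum_negb_signs.
by rewrite !exprM sqrrN.
Qed.

End SignSums.

Section EvaluatedSums.
Variables (K : numClosedFieldType) (n : nat) (v : 'I_n -> K).

Lemma meval_signed_form a xs s :
  (signed_form a xs s).@[v] =
  \sum_(p <- zip (false :: s) [seq p.1 * v p.2 | p <- zip a xs])
    (-1) ^+ p.1 * p.2.
Proof.
rewrite /signed_form raddf_sum /=; move: (false :: s) => u.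
elim: u a xs => [|e u IH] [|a0 a] [|x xs]; rewrite ?big_nil //=.
by rewrite !big_cons /= IH mevalZ mevalXU mulrA.
Qed.

(** Summing out the signs leaves a product of series, one per variable, so that
    the sum over the indices becomes an ordered sum of such products. *)
Lemma meval_power_sum_pm_terms d c a0 (a : seq K) :
  (power_sum (2 * d) (pm_terms n c (a0 :: a))).@[v] =
  c * (2 ^+ size a *
    ecoef (osum [seq (fun x => cosh_poly d (b * x)) | b <- a0 :: a]
                (map v (enum 'I_n))) d).
Proof.
rewrite /power_sum (perm_big _ (pm_termsE n c (a0 :: a))) big_allpairs_dep.
rewrite raddf_sum /osum /ecoef coef_sum size_map (subs_map v) big_map.
rewrite !mulr_sumr.
have prod_zip (bs : seq K) (ys : seq 'I_n) :
    \prod_(z <- [seq p.1 * v p.2 | p <- zip bs ys]) cosh_poly d z =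
    \prod_(p <- zip [seq (fun x => cosh_poly d (b * x)) | b <- bs] (map v ys))
      p.1 p.2.
  elim: bs ys => [|b bs IH] [|y ys]; rewrite ?big_nil //=.
  by rewrite !big_cons IH.
apply: eq_big_seq => -[|x xs]; rewrite mem_subs => /andP[/eqP // [size_xs] _].
pose zs := [seq p.1 * v p.2 | p <- zip a xs].
have size_zs : size zs = size a by rewrite size_map size_zip size_xs minnn.
rewrite raddf_sum /=.
transitivity (c * \sum_(s <- signs (size zs))
    (\sum_(p <- zip (false :: s) (a0 * v x :: zs)) (-1) ^+ p.1 * p.2)
      ^+ (2 * d)).
  rewrite size_zs mulr_sumr; apply: eq_bigr => s _.
  by rewrite mevalZ rmorphXn /= meval_signed_form.
rewrite sum_signs_expr_fst size_zs; congr (_ * (_ * ecoef _ _)).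
rewrite -[a0 * v x :: zs]/[seq p.1 * v p.2 | p <- zip (a0 :: a) (x :: xs)].
exact: prod_zip.
Qed.

End EvaluatedSums.

(** * Polynomials are determined by their values *)

Section PolynomialFunctions.
Variable K : numDomainType.

Lemma horner_inj (p q : {poly K}) : (forall t, p.[t] = q.[t]) -> p = q.
Proof.
move=> eq_pq; apply/eqP; rewrite -subr_eq0; apply/eqP.
set r := p - q; pose ts : seq K := [seq k%:R | k <- iota 0 (size r)].
apply: (@roots_geq_poly_eq0 _ _ ts).
- by apply/allP => _ /mapP[k _ ->]; rewrite rootE !hornerE eq_pq subrr.
- by rewrite map_inj_uniq ?iota_uniq // => j k /eqP; rewrite eqr_nat => /eqP.
- by rewrite size_map size_iota.
Qed.

Lemma digits_inj (D n : nat) (u w : 'I_n -> nat) :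
  (forall i, u i < D)%N -> (forall i, w i < D)%N ->
  (\sum_i u i * D ^ i = \sum_i w i * D ^ i)%N -> u =1 w.
Proof.
elim: n u w => [|n IH] u w lt_u lt_w; first by move=> _ [].
have split_first (t : 'I_n.+1 -> nat) :
    (\sum_i t i * D ^ i
     = (\sum_(i < n) t (lift ord0 i) * D ^ i) * D + t ord0)%N.
  rewrite big_ord_recl expn0 muln1 addnC big_distrl; congr (_ + _)%N.
  by apply: eq_bigr => i _; rewrite /= /bump add1n expnSr mulnA.
rewrite !split_first => eq_uw.
have eq0 : u ord0 = w ord0.
  by move/(congr1 (modn^~ D)): eq_uw; rewrite !modnMDl !modn_small.
have D_gt0 : (0 < D)%N by apply: leq_ltn_trans (lt_u ord0).
move: eq_uw; rewrite eq0 => /addIn/eqP; rewrite eqn_pmul2r // => /eqP eq_uw.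
move=> i; case: (unliftP ord0 i) => [j ->|-> //].
by apply: (IH (fun i => u (lift ord0 i)) (fun i => w (lift ord0 i))).
Qed.

(** Kronecker substitution: on the curve x_i = t^(D^i) with D larger than all
    exponents, distinct monomials become distinct powers of t. *)
Lemma meval_inj n (p q : {mpoly K[n]}) : (forall v, p.@[v] = q.@[v]) -> p = q.
Proof.
move=> eq_pq; apply/eqP; rewrite -subr_eq0; apply/eqP; set r := p - q.
pose D := (msize r).+1; pose code (m : 'X_{1..n}) := (\sum_i m i * D ^ i)%N.
have lt_D m : m \in msupp r -> forall i, (m i < D)%N.
  move=> m_r i; rewrite ltnS (leq_trans _ (ltnW (msize_mdeg_lt m_r))) //.
  by rewrite mdegE (bigD1 i) //= leq_addr.
pose s : {poly K} := \sum_(m <- msupp r) r@_m *: 'X^(code m).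
have s0 : s = 0.
  apply: horner_inj => t; rewrite horner0 -(subrr p.@[fun i => t ^+ (D ^ i)]).
  rewrite {2}eq_pq -mevalB mevalE horner_sum; apply: eq_bigr => m _.
  rewrite hornerZ hornerXn -prodrXr; congr (_ * _).
  by apply: eq_bigr => i _; rewrite -exprM mulnC.
apply/mpolyP => m; rewrite mcoeff0.
have [m_r|/memN_msupp_eq0 //] := boolP (m \in msupp r).
have := congr1 (fun s : {poly K} => s`_(code m)) s0.
rewrite coef0 coef_sum (bigD1_seq m) //= coefZ coefXn eqxx mulr1.
rewrite big1_seq ?addr0 // => m' /andP[neq_m' m'_r].
rewrite coefZ coefXn; case: eqP => [eq_code|_]; last by rewrite mulr0.
case/eqP: neq_m'; apply/mnmP => i.
by apply/esym; apply: digits_inj eq_code i; apply: lt_D.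
Qed.

End PolynomialFunctions.

(** * Arithmetic of series up to the fifth order *)

Section Jets.
Variable R : comNzRingType.
Implicit Types (p q : {poly R}).

Lemma ecoefM p q m :
  ecoef (p * q) m =
  \sum_(j < m.+1) 'C(2 * m, 2 * j)%:R * (ecoef p j * ecoef q (m - j)).
Proof.
rewrite /ecoef coefM mulr_sumr; apply: eq_bigr => j _.
have le_jm : (2 * j <= 2 * m)%N by rewrite leq_mul2l /= -ltnS.
rewrite -(bin_fact le_jm) -mulnBr natrM natrM; ring.
Qed.

(** Series modulo s^6, as explicit tuples so that their sums and products are
    obtained by mere simplification. *)
Definition jet5 := (R * R * R * R * R * R)%type.

Definition jet p : jet5 :=
  (ecoef p 0, ecoef p 1, ecoef p 2, ecoef p 3, ecoef p 4, ecoef p 5).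

Definition jet_add (a b : jet5) : jet5 :=
  let: (a0, a1, a2, a3, a4, a5) := a in
  let: (b0, b1, b2, b3, b4, b5) := b in
  (a0 + b0, a1 + b1, a2 + b2, a3 + b3, a4 + b4, a5 + b5).

Definition jet_scale c (a : jet5) : jet5 :=
  let: (a0, a1, a2, a3, a4, a5) := a in
  (c * a0, c * a1, c * a2, c * a3, c * a4, c * a5).

Definition jet_mul (a b : jet5) : jet5 :=
  let: (a0, a1, a2, a3, a4, a5) := a in
  let: (b0, b1, b2, b3, b4, b5) := b in
  (a0 * b0,
   a0 * b1 + a1 * b0,
   a0 * b2 + 6 * (a1 * b1) + a2 * b0,
   a0 * b3 + 15 * (a1 * b2) + 15 * (a2 * b1) + a3 * b0,
   a0 * b4 + 28 * (a1 * b3) + 70 * (a2 * b2) + 28 * (a3 * b1) + a4 * b0,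
   a0 * b5 + 45 * (a1 * b4) + 210 * (a2 * b3) + 210 * (a3 * b2)
   + 45 * (a4 * b1) + a5 * b0).

Lemma jetD p q : jet (p + q) = jet_add (jet p) (jet q).
Proof. by rewrite /jet !ecoefD. Qed.

Lemma jetN p : jet (- p) = jet_scale (- 1) (jet p).
Proof.
have ecoefN m : ecoef (- p) m = - 1 * ecoef p m.
  by rewrite /ecoef coefN mulN1r mulrN.
by rewrite /jet !ecoefN.
Qed.

Lemma jet_natl (k : nat) p : jet (k%:R * p) = jet_scale k%:R (jet p).
Proof.
have ecoef_natl m : ecoef (k%:R * p) m = k%:R * ecoef p m.
  by rewrite /ecoef (mulr_natl p) coefMn mulrnAr -mulr_natl.
by rewrite /jet !ecoef_natl.
Qed.

Lemma jetM p q : jet (p * q) = jet_mul (jet p) (jet q).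
Proof.
rewrite /jet !ecoefM !big_ord_recr !big_ord0 [jet_mul _ _]/=.
move: (ecoef p) (ecoef q) => a b; rewrite /= !add0r.
by rewrite !muln0 !bin0 !binn !mul1r.
Qed.

Lemma jet_natl_eq (k : nat) p q :
  k%:R * p = q -> k%:R * ecoef p 5 = (jet q).2.
Proof. by move=> <-; rewrite jet_natl. Qed.

End Jets.

Section CoshJets.
Variable K : numFieldType.
Implicit Types (xs : seq K) (p : {poly K}).

Lemma coef_comp_scaleX p (c : K) m : (p \Po (c *: 'X))`_m = c ^+ m * p`_m.
Proof.
rewrite coef_comp_poly; under eq_bigr => i _ do rewrite exprZn coefZ coefXn.
have [lt_m|le_m] := ltnP m (size p); last first.
  rewrite [p`_m]nth_default // mulr0 big1 // => i _.
  by rewrite gtn_eqF ?mulr0 // (leq_trans _ le_m).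
rewrite (bigD1 (Ordinal lt_m)) //= eqxx big1 => [|i neq_im].
  by rewrite mulr1 addr0 mulrC.
case: eqP => [eq_mi|_]; last by rewrite !mulr0.
by case/eqP: neq_im; apply: val_inj.
Qed.

(** The series c(bx) depends on x through x^2 s only. Products of such series
    inherit this property, and it is what makes the coefficients of their sums
    over x multiples of sums of even powers. *)
Lemma cosh_polyZ d (b x : K) :
  cosh_poly d (b * x) = cosh_poly d b \Po (x ^+ 2 *: 'X).
Proof.
apply/polyP => m; rewrite coef_comp_scaleX !coef_poly -exprM exprMn.
by case: ifP => _; rewrite ?mulr0 // mulrA; congr (_ / _); rewrite mulrC.
Qed.

Definition even_power_sum xs m : K := \sum_(x <- xs) x ^+ (2 * m).

Lemma jet_psum (h : K -> {poly K}) p xs :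
  (forall x, h x = p \Po (x ^+ 2 *: 'X)) ->
  jet (psum h xs) =
  let: (a0, a1, a2, a3, a4, a5) := jet p in
  let Y := even_power_sum xs in
  (a0 * Y 0, a1 * Y 1, a2 * Y 2, a3 * Y 3, a4 * Y 4, a5 * Y 5).
Proof.
move=> hE.
have ecoefE m : ecoef (psum h xs) m = ecoef p m * even_power_sum xs m.
  rewrite /ecoef -mulrA; congr (_ * _).
  rewrite /psum /even_power_sum coef_sum mulr_sumr; apply: eq_bigr => x _.
  by rewrite hE coef_comp_scaleX -exprM mulrC.
by rewrite /jet !ecoefE.
Qed.

Lemma jet_cosh_poly (b : K) :
  jet (cosh_poly 5 b) = (1, b ^+ 2, b ^+ 4, b ^+ 6, b ^+ 8, b ^+ 10).
Proof.
have ecoefE m : (m < 6)%N -> ecoef (cosh_poly 5 b) m = b ^+ (2 * m).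
  rewrite /ecoef coef_poly => ->; rewrite mulrC divfK //.
  by rewrite pnatr_eq0 -lt0n fact_gt0.
by rewrite /jet !ecoefE // muln0 expr0.
Qed.

(** * The identity at a point *)

(** Once the symmetric sums are expanded, the right-hand side is a combination
    of the monomials Y_1^(m_1) ... Y_5^(m_5) with m_1 + 2 m_2 + ... + 5 m_5 = 5,
    where Y_m is the sum of the 2m-th powers. The coefficients, which are
    polynomials in n, vanish for all monomials but Y_1^5. The integers 15120,
    15086 and 35592 are written as 126 * 120, 38 * 397 and 24 * 1483. *)
Lemma quintic_point_identity xs (N := (size xs)%:R : K)
    (f := fun x : K => cosh_poly 5 (1 * x))
    (g := fun x : K => cosh_poly 5 (2 * x)) :
  126 * 120 * even_power_sum xs 1 ^+ 5 =
    2 ^+ 4 * ecoef (osum [:: f; f; f; f; f] xs) 5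
  - 2 * (N - 7) * (2 ^+ 3 * ecoef (osum [:: f; f; f; f] xs) 5)
  + 2 * (N ^+ 2 - 13 * N + 36) * (2 ^+ 2 * ecoef (osum [:: f; f; f] xs) 5)
  + 2 / 3 * (2 ^+ 2 * ecoef (osum [:: g; f; f] xs + osum [:: f; g; f] xs
                             + osum [:: f; f; g] xs) 5)
  - 4 / 3 * (N ^+ 3 - 18 * N ^+ 2 + 90 * N - 226)
    * (2 * ecoef (osum [:: f; f] xs) 5)
  - 4 / 3 * (N - 4) * (2 * ecoef (osum [:: f; g] xs + osum [:: g; f] xs) 5)
  + 2 / 3 * (N ^+ 4 - 22 * N ^+ 3 + 2195 * N ^+ 2 - 38 * 397 * N + 24 * 1483)
    * ecoef (osum [:: f] xs) 5.
Proof.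
pose F := cosh_poly 5 (1 : K); pose G := cosh_poly 5 (2 : K).
have fE x : f x = F \Po (x ^+ 2 *: 'X) by exact: cosh_polyZ.
have gE x : g x = G \Po (x ^+ 2 *: 'X) by exact: cosh_polyZ.
have fXE k x : f x ^+ k = (F ^+ k) \Po (x ^+ 2 *: 'X) by rewrite fE rmorphXn.
have fgE x : f x * g x = (F * G) \Po (x ^+ 2 *: 'X).
  by rewrite fE gE rmorphM.
have fXgE k x : f x ^+ k * g x = (F ^+ k * G) \Po (x ^+ 2 *: 'X).
  by rewrite fXE gE rmorphM.
have -> : N = even_power_sum xs 0.
  rewrite /N /even_power_sum; under eq_bigr => x _ do rewrite muln0 expr0.
  by rewrite big_const_seq count_predT iter_addr_0.
have H5 := jet_natl_eq (osum_nseq5 f xs).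
have H4 := jet_natl_eq (osum_nseq4 f xs).
have H3 := jet_natl_eq (osum_nseq3 f xs).
have H211 := jet_natl_eq (osum3 f g xs).
have H2 := jet_natl_eq (osum_nseq2 f xs).
have H21 := jet_natl_eq (k := 1) (etrans (mul1r _) (osum2 f g xs)).
have H1 := jet_natl_eq (k := 1) (etrans (mul1r _) (osum1 f xs)).
(* Each symmetric sum becomes an explicit polynomial in the sums of even
   powers of xs. *)
rewrite ?(exprS, expr0, mulr1) -?mulrA ?(jetD, jetN, jet_natl, jetM)
  in H5 H4 H3 H211 H2 H21 H1.
rewrite ?(jet_psum _ fE) ?(jet_psum _ gE) ?(jet_psum _ fgE)
  ?(jet_psum _ (fXE _)) ?(jet_psum _ (fXgE _)) in H5 H4 H3 H211 H2 H21 H1.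
rewrite ?(exprS, expr0, mulr1) ?jetM ?jet_cosh_poly /= ?expr1n
  in H5 H4 H3 H211 H2 H21 H1.
set e5 := ecoef (osum [:: f; f; f; f; f] xs) 5 in H5 *.
set e4 := ecoef (osum [:: f; f; f; f] xs) 5 in H4 *.
set e3 := ecoef (osum [:: f; f; f] xs) 5 in H3 *.
set e2 := ecoef (osum [:: f; f] xs) 5 in H2 *.
set e1 := ecoef (osum [:: f] xs) 5 in H1 *.
set e21 := ecoef (_ + _) 5 in H21 *.
set e211 := ecoef (_ + _ + _) 5 in H211 *.
move: (even_power_sum xs) H5 H4 H3 H211 H2 H21 H1 => Y.
move: (Y 0) (Y 1) (Y 2) (Y 3) (Y 4) (Y 5) => y0 y1 y2 y3 y4 y5.
move: e5 e4 e3 e211 e2 e21 e1 => e5 e4 e3 e211 e2 e21 e1.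
move=> H5 H4 H3 H211 H2 H21 H1.
(* The factor 15 clears the denominators 120, 24, 6, 2 of the Newton-type
   identities and 3 of the coefficients. *)
apply: (@mulfI _ 15); first by rewrite pnatr_eq0.
transitivity
  (2 * (120 * e5) - 10 * (y0 - 7) * (24 * e4)
   + 20 * (y0 ^+ 2 - 13 * y0 + 36) * (6 * e3) + 20 * (2 * e211)
   - 20 * (y0 ^+ 3 - 18 * y0 ^+ 2 + 90 * y0 - 226) * (2 * e2)
   - 40 * (y0 - 4) * (1 * e21)
   + 10 * (y0 ^+ 4 - 22 * y0 ^+ 3 + 2195 * y0 ^+ 2 - 38 * 397 * y0 + 24 * 1483)
     * (1 * e1)); last by field.
rewrite H5 H4 H3 H211 H2 H21 H1 {H5 H4 H3 H211 H2 H21 H1}.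
ring.
Qed.

End CoshJets.

(** * Sums of powers after absorbing the coefficients *)

Section Absorption.
Variables (K : numClosedFieldType) (n d : nat) (N : K).
Implicit Types (c : K) (a : seq K) (W : seq (K * {mpoly K[n]})).

Lemma power_sum_cat W1 W2 :
  power_sum d (W1 ++ W2) = power_sum d W1 + power_sum d W2.
Proof. exact: big_cat. Qed.

Lemma sum_absorb W : (0 < d)%N ->
  \sum_(l <- absorb d N W) l ^+ d = N^-1 *: power_sum d W.
Proof.
move=> d_gt0; rewrite /absorb /power_sum big_map big_filter scaler_sumr.
rewrite [RHS](bigID (fun w => w.1 / N != 0)) /= [X in _ + X]big1 ?addr0.
  by apply: eq_bigr => w _; rewrite exprZn rootCK // scalerA mulrC.
by move=> w /negPn/eqP w0; rewrite scalerA mulrC w0 scale0r.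
Qed.

Lemma pm_form_homog a (i : (size a).-tuple 'I_n) s : pm_form i s \is 1.-homog.
Proof.
by apply: rpred_sum => j _; apply: rpredZ; rewrite dhomogX; apply/eqP/mdeg1.
Qed.

Lemma absorb_homog W :
  {in W, forall w, w.2 \is 1.-homog} ->
  {in absorb d N W, forall l, l \is 1.-homog}.
Proof.
move=> hom_W l /mapP[w + ->]; rewrite mem_filter => /andP[_ W_w].
by apply: rpredZ; apply: hom_W.
Qed.

Lemma size_absorb_cat W1 W2 :
  size (absorb d N (W1 ++ W2)) = (size (absorb d N W1) + size (absorb d N W2))%N.
Proof. by rewrite /absorb filter_cat map_cat size_cat. Qed.

Lemma size_absorb_pm_terms c a :
  size (absorb d N (pm_terms n c a)) =
  ((c / N != 0)%R * ('C(n, size a) * 2 ^ (size a).-1))%N.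
Proof.
rewrite /absorb size_map size_filter /pm_terms.
rewrite (eq_in_count (a2 := fun=> c / N != 0)); last first.
  by move=> _ /allpairsP[p [_ _ ->]].
case: (_ != 0); last by rewrite count_pred0.
rewrite count_predT size_allpairs mul1n -!cardE card_ltn_sorted_tuples.
by rewrite card_tuple card_bool.
Qed.

End Absorption.

Section Distinctness.
Variables (K : numClosedFieldType) (n : nat).
Implicit Types (b : seq nat) (xs : seq 'I_n) (s : seq bool).

Local Notation nats b := (map (fun k : nat => k%:R : K) b).

Lemma mcoeff_signed_form_notin (a : seq K) xs s x :
  x \notin xs -> (signed_form a xs s)@_U_(x) = 0.
Proof.
move=> x_notin; rewrite /signed_form raddf_sum big1_seq // => p /= p_in.
rewrite mcoeffZ mcoeffXU; case: eqP => [eq_px|]; last by rewrite mulr0.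
case/negP: x_notin; rewrite -eq_px.
move: p_in; move: (zip (false :: s) a) => u.
elim: u xs => [|v u IH] [|y ys] //=; rewrite inE => /orP[/eqP -> /=|/IH].
  by rewrite mem_head.
by rewrite inE => ->; rewrite orbT.
Qed.

Lemma mcoeff_signed_form_nth (a : seq K) xs s x0 j :
  uniq xs -> size xs = size a -> size s = (size a).-1 -> (j < size a)%N ->
  (signed_form a xs s)@_U_(nth x0 xs j) =
  (-1) ^+ nth false (false :: s) j * a`_j.
Proof.
move=> uniq_xs size_xs size_s lt_j.
have size_u : size (false :: s) = size a.
  by rewrite /= size_s prednK // (leq_ltn_trans _ lt_j).
pose z0 : bool * K * 'I_n := ((false, 0), x0).
have size_z : size (zip (false :: s) a) = size xs.
  by rewrite size_zip size_u minnn.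
rewrite /signed_form raddf_sum (big_nth z0) big_mkord size_zip size_z minnn.
rewrite -size_xs in lt_j.
rewrite (bigD1 (Ordinal lt_j)) //= big1 ?addr0 => [|k neq_kj].
  by rewrite !nth_zip //= mcoeffZ mcoeffXU eqxx mulr1.
rewrite !nth_zip //= mcoeffZ mcoeffXU nth_uniq //.
by rewrite (negPf neq_kj : (k : nat) == j = false) mulr0.
Qed.

(** Proportionality of vectors whose first entries are nonzero. *)
Definition proportional b b' :=
  (size b == size b') &&
  all (fun p => p.1 * head 0 b' == head 0 b * p.2)%N (zip b b').

Lemma mcoeff_signed_form_neq0 b xs s x :
    0%N \notin b -> uniq xs -> size xs = size b -> size s = (size b).-1 ->
  ((signed_form (nats b) xs s)@_U_(x) != 0) = (x \in xs).
Proof.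
move=> b_pos uniq_xs size_xs size_s.
have [x_in|/mcoeff_signed_form_notin -> //] := boolP (x \in xs); last first.
  by rewrite eqxx.
have lt_x : (index x xs < size b)%N by rewrite -size_xs index_mem.
rewrite -{1}(nth_index x x_in) mcoeff_signed_form_nth ?size_map //.
rewrite (nth_map 0%N) // mulf_neq0 ?signr_eq0 // pnatr_eq0.
by apply: contraNneq b_pos => <-; rewrite mem_nth.
Qed.

Lemma signed_nat_inj (e e' : bool) (k k' : nat) : (0 < k)%N ->
  (-1) ^+ e * k%:R = (-1) ^+ e' * k'%:R :> K -> e = e' /\ k = k'.
Proof.
move=> k_gt0 eq_k.
have eq_kk : k = k'.
  have := congr1 Num.norm eq_k.
  rewrite !normrM !normr_sign !normr_nat !mul1r => /eqP.
  by rewrite eqr_nat => /eqP.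
split=> //; move: eq_k; rewrite -eq_kk => /mulIf; rewrite pnatr_eq0 -lt0n k_gt0.
move=> /(_ isT) /eqP; case: e e' => [] [] //=; rewrite ?expr0 ?expr1.
  by rewrite eq_sym -subr_eq0 opprK -mulr2n pnatr_eq0.
by rewrite -subr_eq0 opprK -mulr2n pnatr_eq0.
Qed.

(** The support of the form gives the indices. The first coefficient carries no
    sign, so it eliminates the scalars l and l'; what remains are equalities
    between integers, whose signs and absolute values agree. *)
Lemma scaled_signed_form_inj b b' xs xs' s s' (l l' : K) :
    b != [::] -> 0%N \notin b -> 0%N \notin b' -> l != 0 -> l' != 0 ->
    xs \in subs (size b) (enum 'I_n) -> xs' \in subs (size b') (enum 'I_n) ->
    s \in signs (size b).-1 -> s' \in signs (size b').-1 ->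
    l *: signed_form (nats b) xs s = l' *: signed_form (nats b') xs' s' ->
  [/\ proportional b b', xs = xs' & s = s'].
Proof.
move=> b_neq0 b_pos b'_pos l_neq0 l'_neq0; rewrite !mem_subs !mem_signs.
move=> /andP[/eqP size_xs sub_xs] /andP[/eqP size_xs' sub_xs'].
move=> /eqP size_s /eqP size_s' eq_form.
have uniq_enum := enum_uniq 'I_n.
have uniq_xs := subseq_uniq sub_xs uniq_enum.
have uniq_xs' := subseq_uniq sub_xs' uniq_enum.
have eq_coef x := congr1 (fun p : {mpoly K[n]} => p@_U_(x)) eq_form.
have eq_xs : xs = xs'.
  rewrite (subseq_uniqP uniq_enum sub_xs) (subseq_uniqP uniq_enum sub_xs').
  apply: eq_filter => x /=.
  rewrite -(mcoeff_signed_form_neq0 x b_pos uniq_xs size_xs size_s).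
  rewrite -(mcoeff_signed_form_neq0 x b'_pos uniq_xs' size_xs' size_s').
  move: (eq_coef x); rewrite !mcoeffZ => eq_x.
  by rewrite -(mulrI_eq0 _ (lregP l_neq0)) eq_x mulrI_eq0 //; apply/lregP.
have eq_size : size b = size b' by rewrite -size_xs eq_xs.
rewrite -eq_size in size_s'.
have size_gt0 : (0 < size b)%N by rewrite lt0n size_eq0.
have nth_pos b1 j : 0%N \notin b1 -> (j < size b1)%N -> (0 < nth 0 b1 j)%N.
  by move=> pos lt_j; rewrite lt0n; apply: contraNneq pos => <-; rewrite mem_nth.
have eq_nth j : (j < size b)%N ->
    l * ((-1) ^+ nth false (false :: s) j * (nth 0 b j)%:R) =
    l' * ((-1) ^+ nth false (false :: s') j * (nth 0 b' j)%:R).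
  move=> lt_j.
  have x0 : 'I_n.
    by case: (xs) (size_xs) => [/= e0|x //]; rewrite -e0 in size_gt0.
  move: (eq_coef (nth x0 xs j)); rewrite !mcoeffZ -eq_xs.
  rewrite !mcoeff_signed_form_nth ?size_map -?eq_size //.
  by rewrite !(nth_map 0%N) // -eq_size.
have := eq_nth 0%N size_gt0; rewrite /= expr0 !mul1r !nth0 => eq_head.
have eq_sb j : (j < size b)%N ->
    nth false (false :: s) j = nth false (false :: s') j /\
    (nth 0 b j * head 0 b' = head 0 b * nth 0 b' j)%N.
  move=> lt_j; apply: signed_nat_inj.
    by rewrite muln_gt0 nth_pos // -nth0 nth_pos -?eq_size.
  apply: (mulfI l_neq0); rewrite !natrM.
  transitivity (l * ((-1) ^+ nth false (false :: s) j * (nth 0 b j)%:R) *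
                (head 0 b')%:R); first by rewrite -!mulrA.
  rewrite eq_nth //; transitivity (l * (head 0 b)%:R *
    ((-1) ^+ nth false (false :: s') j * (nth 0 b' j)%:R)); last by ring.
  by rewrite eq_head; ring.
split=> //; last first.
  apply: (@eq_from_nth _ false) => [|j]; first by rewrite size_s size_s'.
  rewrite size_s -ltnS prednK // => lt_j.
  by have [] := eq_sb _ lt_j.
rewrite /proportional eq_size eqxx; apply/(all_nthP (0, 0)%N) => j.
rewrite size_zip -eq_size minnn => lt_j; rewrite nth_zip //=.
by have [_ ->] := eq_sb _ lt_j.
Qed.

Lemma absorb_uniq d (N : K) (sh : seq (K * seq nat)) : (0 < d)%N ->
    all (fun b => (b != [::]) && (0%N \notin b)) (unzip2 sh) ->
    uniq (unzip2 sh) ->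
    {in unzip2 sh &, forall b b', proportional b b' -> b = b'} ->
  uniq (absorb d N (flatten [seq pm_terms n p.1 (nats p.2) | p <- sh])).
Proof.
move=> d_gt0 /allP pos_sh uniq_sh sep_sh.
pose choices (p : K * seq nat) :=
  [seq (xs, s) | xs <- subs (size p.2) (enum 'I_n), s <- signs (size p.2).-1].
pose idx := [seq (p, z) | p <- sh, z <- choices p].
pose form (q : (K * seq nat) * (seq 'I_n * seq bool)) :=
  (q.1.1, signed_form (nats q.1.2) q.2.1 q.2.2).
have perm_W : perm_eq (flatten [seq pm_terms n p.1 (nats p.2) | p <- sh])
                      (map form idx).
  rewrite {pos_sh uniq_sh sep_sh}/idx; elim: sh => [|p sh IH] //=.
  rewrite map_cat; apply: perm_cat => //.
  rewrite -map_comp /choices; apply: (perm_trans (pm_termsE n p.1 _)).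
  by rewrite size_map map_allpairs.
rewrite (perm_uniq (perm_map _ (perm_filter _ perm_W))) filter_map -map_comp.
have sepP p p' : p \in sh -> p' \in sh -> proportional p.2 p'.2 -> p = p'.
  move=> p_sh p'_sh prop_pp'.
  have := sep_sh _ _ (map_f snd p_sh) (map_f snd p'_sh) prop_pp'.
  move/(congr1 (index^~ (unzip2 sh))).
  rewrite -{1}(nth_index p p_sh) -{1}(nth_index p p'_sh).
  rewrite -!(nth_map p [::] snd) ?index_mem //.
  rewrite !index_uniq ?size_map ?index_mem //.
  by move=> eq_i; rewrite -(nth_index p p_sh) eq_i nth_index.
rewrite map_inj_in_uniq; last first.
  move=> q q'; rewrite !mem_filter => /andP[q_neq0 q_idx] /andP[q'_neq0 q'_idx].
  case/allpairsPdep: q_idx q_neq0 => [p [z [p_sh z_in ->]]].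
  case/allpairsP: z_in => [[xs s] [/= xs_in s_in ->]] /= p_neq0.
  case/allpairsPdep: q'_idx q'_neq0 => [p' [z' [p'_sh z'_in ->]]].
  case/allpairsP: z'_in => [[xs' s'] [/= xs'_in s'_in ->]] /= p'_neq0.
  have /andP[p_nil p_pos] := pos_sh _ (map_f snd p_sh).
  have /andP[_ p'_pos] := pos_sh _ (map_f snd p'_sh).
  have root_neq0 := rootC_eq0 _ d_gt0.
  case/scaled_signed_form_inj; rewrite ?root_neq0 //.
  by move=> /(sepP _ _ p_sh p'_sh) -> -> ->.
rewrite filter_uniq //.
apply: allpairs_uniq_dep => [|p _|]; first exact: map_uniq uniq_sh.
  apply: allpairs_uniq; rewrite ?signs_uniq ?subs_uniq ?enum_uniq //.
  by move=> [x s] [x' s'] _ _ /= [-> ->].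
by move=> [p z] [p' z'] _ _ /= [-> ->].
Qed.

End Distinctness.

(** * The coefficients and the size as functions of the number of variables *)

Section Coefficients.
Variables (F : numFieldType) (n : nat).
Let N : F := n%:R.

Lemma natr_subr_eq0 m : (N - m%:R == 0) = (n == m).
Proof. by rewrite subr_eq0 eqr_nat. Qed.

Lemma coef4_eq0 : (- 2 * (N - 7) == 0) = (n == 7%N).
Proof. by rewrite mulf_eq0 oppr_eq0 pnatr_eq0 natr_subr_eq0. Qed.

Lemma coef3_eq0 : (2 * (N ^+ 2 - 13 * N + 36) == 0) = (n == 4%N) || (n == 9%N).
Proof.
have -> : N ^+ 2 - 13 * N + 36 = (N - 4) * (N - 9) by ring.
by rewrite !mulf_eq0 pnatr_eq0 !natr_subr_eq0.
Qed.

Lemma coef21_eq0 : (- (4 / 3) * (N - 4) == 0) = (n == 4%N).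
Proof.
by rewrite !mulf_eq0 oppr_eq0 mulf_eq0 invr_eq0 !pnatr_eq0 natr_subr_eq0.
Qed.

(** The cubic is (n - 12) ((n - 3)^2 + 9) - 10: it is negative for n <= 12, and
    positive beyond, since already 10^2 + 9 > 10. *)
Lemma coef2_neq0 : - (4 / 3) * (N ^+ 3 - 18 * N ^+ 2 + 90 * N - 226) != 0.
Proof.
rewrite mulf_neq0 // ?oppr_eq0 ?mulf_neq0 ?invr_eq0 ?pnatr_eq0 //.
have -> : N ^+ 3 - 18 * N ^+ 2 + 90 * N - 226
  = (n%:Z ^+ 3 - 18 * n%:Z ^+ 2 + 90 * n%:Z - 226)%:~R by ring.
rewrite intr_eq0; apply/negP => /eqP.
have [lt_n13|] := ltnP n 13; last by nia.
have : (n%:Z - 12) * ((n%:Z - 3) ^+ 2 + 9) <= 0.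
  by rewrite mulr_le0_ge0 ?addr_ge0 ?sqr_ge0 //; lia.
nia.
Qed.

Lemma coef1_neq0 :
  2 / 3 * (N ^+ 4 - 22 * N ^+ 3 + 2195 * N ^+ 2 - 15086%:R * N + 35592%:R) != 0.
Proof.
rewrite mulf_neq0 // ?mulf_neq0 ?invr_eq0 ?pnatr_eq0 //.
(* Completing squares leaves a polynomial with positive coefficients. *)
have -> : N ^+ 4 - 22 * N ^+ 3 + 2195 * N ^+ 2 - 15086%:R * N + 35592%:R
  = ((n%:Z * (n%:Z - 11)) ^+ 2 + 2000 * (n%:Z - 4) ^+ 2
     + (74 * n ^ 2 + 914 * n + 3592)%N%:Z)%:~R by ring.
rewrite intr_eq0 lt0r_neq0 //.
have s1 := sqr_ge0 (n%:Z * (n%:Z - 11)); have s2 := sqr_ge0 (n%:Z - 4).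
lia.
Qed.

End Coefficients.

Lemma natr_ffact (R : nzRingType) n m :
  (n ^_ m)%:R = \prod_(i < m) (n%:R - i%:R) :> R.
Proof.
elim: m => [|m IH]; first by rewrite ffactn0 big_ord0.
rewrite ffactnSr natrM IH big_ord_recr /=.
have [le_mn|lt_nm] := leqP m n; first by rewrite natrB.
by rewrite -IH ffact_small // !mul0r.
Qed.

Lemma natr_bin (F : numFieldType) n m :
  'C(n, m)%:R = \prod_(i < m) (n%:R - i%:R) / m`!%:R :> F.
Proof.
by rewrite -natr_ffact -bin_ffact natrM mulfK // pnatr_eq0 -lt0n fact_gt0.
Qed.

Lemma size_polynomial n :
  (16 * 'C(n, 5) + 8 * 'C(n, 4) + 16 * 'C(n, 3) + 6 * 'C(n, 2) + n)%N%:R =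
  2 / 15 * n%:R ^+ 5 - n%:R ^+ 4 + 16 / 3 * n%:R ^+ 3
  - 8 * n%:R ^+ 2 + 68 / 15 * n%:R :> rat.
Proof.
transitivity (16 * 'C(n, 5)%:R + 8 * 'C(n, 4)%:R + 16 * 'C(n, 3)%:R
              + 6 * 'C(n, 2)%:R + n%:R : rat); first by ring.
rewrite !natr_bin !big_ord_recr !big_ord0 /=.
by rewrite -[5`!]/120%N -[4`!]/24%N -[3`!]/6%N -[2`!]/2%N; field.
Qed.

(** * The decomposition of the fifth power *)

Section Quintic.
Variables (K : numClosedFieldType) (n : nat).

(** The coefficients are left arbitrary here: the absorbed forms are distinct
    whatever they are, and the size depends only on which of them vanish. *)
Definition quintic_terms (c5 c4 c3 c211 c2 c21 c1 : K) :
    seq (K * {mpoly K[n]}) :=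
     pm_terms n c5 [:: 1; 1; 1; 1; 1]
  ++ pm_terms n c4 [:: 1; 1; 1; 1]
  ++ pm_terms n c3 [:: 1; 1; 1]
  ++ (pm_terms n c211 [:: 2; 1; 1]
      ++ pm_terms n c211 [:: 1; 2; 1]
      ++ pm_terms n c211 [:: 1; 1; 2])
  ++ pm_terms n c2 [:: 1; 1]
  ++ (pm_terms n c21 [:: 2; 1] ++ pm_terms n c21 [:: 1; 2])
  ++ pm_terms n c1 [:: 1].

Lemma meval_quintic_terms (v : 'I_n -> K) c5 c4 c3 c211 c2 c21 c1
    (f := fun x : K => cosh_poly 5 (1 * x))
    (g := fun x : K => cosh_poly 5 (2 * x)) (xs := map v (enum 'I_n)) :
  (power_sum 10 (quintic_terms c5 c4 c3 c211 c2 c21 c1)).@[v] =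
     c5 * (2 ^+ 4 * ecoef (osum [:: f; f; f; f; f] xs) 5)
   + c4 * (2 ^+ 3 * ecoef (osum [:: f; f; f; f] xs) 5)
   + c3 * (2 ^+ 2 * ecoef (osum [:: f; f; f] xs) 5)
   + c211 * (2 ^+ 2 * ecoef (osum [:: g; f; f] xs + osum [:: f; g; f] xs
                             + osum [:: f; f; g] xs) 5)
   + c2 * (2 * ecoef (osum [:: f; f] xs) 5)
   + c21 * (2 * ecoef (osum [:: f; g] xs + osum [:: g; f] xs) 5)
   + c1 * ecoef (osum [:: f] xs) 5.
Proof.
have ev c a0 a : (power_sum 10 (pm_terms n c (a0 :: a))).@[v] = _ :=
  meval_power_sum_pm_terms v 5 c a0 a.
rewrite /quintic_terms !power_sum_cat !mevalD !ev -/xs !ecoefD /=.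
by rewrite -/f -/g; ring.
Qed.

Lemma size_absorb_quintic_terms (N : K) c5 c4 c3 c211 c2 c21 c1 :
  size (absorb 10 N (quintic_terms c5 c4 c3 c211 c2 c21 c1)) =
  ((c5 / N != 0)%R * (16 * 'C(n, 5)) + (c4 / N != 0)%R * (8 * 'C(n, 4))
   + (c3 / N != 0)%R * (4 * 'C(n, 3)) + (c211 / N != 0)%R * (12 * 'C(n, 3))
   + (c2 / N != 0)%R * (2 * 'C(n, 2)) + (c21 / N != 0)%R * (4 * 'C(n, 2))
   + (c1 / N != 0)%R * n)%N.
Proof.
rewrite /quintic_terms !size_absorb_cat !size_absorb_pm_terms /= bin1.
rewrite -[(2 ^ 4)%N]/16%N -[(2 ^ 3)%N]/8%N -[(2 ^ 2)%N]/4%N.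
rewrite -[(2 ^ 1)%N]/2%N -[(2 ^ 0)%N]/1%N.
lia.
Qed.

Lemma quintic_terms_homog c5 c4 c3 c211 c2 c21 c1 :
  {in quintic_terms c5 c4 c3 c211 c2 c21 c1, forall w, w.2 \is 1.-homog}.
Proof.
have hom c a : {in pm_terms n c a, forall w, w.2 \is 1.-homog}.
  by move=> w /allpairsP[[i s] [_ _ ->]]; apply: pm_form_homog.
move=> w; rewrite !mem_cat => w_in.
by repeat (case/orP: w_in => w_in); apply: hom w_in.
Qed.

Lemma absorb_quintic_terms_uniq (N : K) c5 c4 c3 c211 c2 c21 c1 :
  uniq (absorb 10 N (quintic_terms c5 c4 c3 c211 c2 c21 c1)).
Proof.
pose sh : seq (K * seq nat) :=
  [:: (c5, [:: 1; 1; 1; 1; 1]%N); (c4, [:: 1; 1; 1; 1]%N);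
      (c3, [:: 1; 1; 1]%N); (c211, [:: 2; 1; 1]%N);
      (c211, [:: 1; 2; 1]%N); (c211, [:: 1; 1; 2]%N); (c2, [:: 1; 1]%N);
      (c21, [:: 2; 1]%N); (c21, [:: 1; 2]%N); (c1, [:: 1]%N)].
have -> : quintic_terms c5 c4 c3 c211 c2 c21 c1 =
    flatten [seq pm_terms n p.1 [seq k%:R | k <- p.2] | p <- sh].
  by rewrite /quintic_terms /= cats0 -!catA.
apply: absorb_uniq => // b b' b_sh b'_sh.
have : all (fun b => all (fun b' => proportional b b' ==> (b == b'))
                         (unzip2 sh)) (unzip2 sh) by [].
by move=> /allP/(_ _ b_sh)/allP/(_ _ b'_sh)/implyP prop_eq /prop_eq/eqP.
Qed.

Let N : K := n%:R.

Definition quintic_combination : seq (K * {mpoly K[n]}) :=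
  quintic_terms 1 (- 2 * (N - 7)) (2 * (N ^+ 2 - 13 * N + 36)) (2 / 3)
    (- (4 / 3) * (N ^+ 3 - 18 * N ^+ 2 + 90 * N - 226)) (- (4 / 3) * (N - 4))
    (2 / 3 * (N ^+ 4 - 22 * N ^+ 3 + 2195 * N ^+ 2
              - 15086%:R * N + 35592%:R)).

Lemma quintic_identity :
  15120%:R *: qform K n ^+ 5 = power_sum 10 quintic_combination.
Proof.
apply: meval_inj => v; rewrite mevalZ rmorphXn /qform raddf_sum.
pose xs := map v (enum 'I_n).
have -> : \sum_(i < n) ('X_i ^+ 2).@[v] = even_power_sum xs 1.
  rewrite /even_power_sum big_map big_enum; apply: eq_bigr => i _.
  by rewrite rmorphXn /= mevalXU.
rewrite meval_quintic_terms -/xs.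
have := quintic_point_identity xs; rewrite size_map size_enum_ord -/N.
move: (even_power_sum xs 1) => y id_xs.
apply: (etrans (y := 126 * 120 * y ^+ 5)); first by ring.
by apply: (etrans id_xs); field.
Qed.

Lemma size_quintic_combination :
  size (absorb 10 15120%:R quintic_combination) =
  (16 * 'C(n, 5) + (n != 7) * (8 * 'C(n, 4))
   + (~~ ((n == 4) || (n == 9))) * (4 * 'C(n, 3)) + 12 * 'C(n, 3)
   + 2 * 'C(n, 2) + (n != 4) * (4 * 'C(n, 2)) + n)%N.
Proof.
have neq0 c : (c / 15120%:R != 0 :> K) = (c != 0).
  by rewrite mulf_eq0 invr_eq0 pnatr_eq0 orbF.
rewrite size_absorb_quintic_terms !neq0 coef4_eq0 coef3_eq0 coef21_eq0.
rewrite coef2_neq0 coef1_neq0 oner_neq0 (_ : 2 / 3 != 0 :> K) ?mul1n //.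
by rewrite mulf_neq0 ?invr_eq0 ?pnatr_eq0.
Qed.

Lemma quintic_decomposition :
  is_decomposition 10 (qform K n ^+ 5) (absorb 10 15120%:R quintic_combination).
Proof.
split; first by apply: absorb_homog; apply: quintic_terms_homog.
  exact: absorb_quintic_terms_uniq.
rewrite sum_absorb // -quintic_identity scalerA mulVf ?scale1r //.
by rewrite pnatr_eq0.
Qed.

End Quintic.

Theorem proposition3p7 (R : realType) (n : nat) :
  let C : numClosedFieldType := R[i] in
  let N : C := n%:R in
  let W : seq (C * {mpoly C[n]}) :=
       pm_terms n 1 [:: 1; 1; 1; 1; 1]
    ++ pm_terms n (- 2 * (N - 7)) [:: 1; 1; 1; 1]
    ++ pm_terms n (2 * (N ^+ 2 - 13 * N + 36)) [:: 1; 1; 1]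
    ++ (pm_terms n (2 / 3) [:: 2; 1; 1]
        ++ pm_terms n (2 / 3) [:: 1; 2; 1]
        ++ pm_terms n (2 / 3) [:: 1; 1; 2])
    ++ pm_terms n (- (4 / 3) * (N ^+ 3 - 18 * N ^+ 2 + 90 * N - 226)) [:: 1; 1]
    ++ (pm_terms n (- (4 / 3) * (N - 4)) [:: 2; 1]
        ++ pm_terms n (- (4 / 3) * (N - 4)) [:: 1; 2])
    ++ pm_terms n (2 / 3 * (N ^+ 4 - 22 * N ^+ 3 + 2195 * N ^+ 2
                            - 15086%:R * N + 35592%:R)) [:: 1] in
  let L : seq {mpoly C[n]} := absorb 10 15120%:R W in
  let r : nat :=
    (16 * 'C(n, 5) + 8 * 'C(n, 4) + 16 * 'C(n, 3) + 6 * 'C(n, 2) + n)%N in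
  [/\ 15120%:R *: qform C n ^+ 5 = power_sum 10 W,
      is_decomposition 10 (qform C n ^+ 5) L,
      (5 <= n)%N -> n <> 7%N ->
        (n <> 9%N -> size L = r) /\
        r%:R = 2 / 15 * n%:R ^+ 5 - n%:R ^+ 4 + 16 / 3 * n%:R ^+ 3
               - 8 * n%:R ^+ 2 + 68 / 15 * n%:R :> rat,
      n = 7%N -> size L = 1029%N
    & n = 9%N -> size L = 4257%N].
Proof.
move=> C N W L r.
have sizeL := size_quintic_combination C n : size L = _.
split.
- exact: quintic_identity.
- exact: quintic_decomposition.
- move=> n_ge5 n_neq7; split; last exact: size_polynomial.
  move=> n_neq9; rewrite sizeL /r.
  have [-> -> ->] :
      [/\ (n == 4%N) = false, (n == 7%N) = false & (n == 9%N) = false].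
    by split; apply/eqP => //; lia.
  lia.
- by move=> n7; rewrite sizeL n7.
- by move=> n9; rewrite sizeL n9.
Qed.
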